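(* Uniformly for real $x\ge 1$ and $y>e^{e^{e}}$, we have $$\frac{1}{y}\sum_{x\le n\le x+y} f(n)\ \ge\ \exp\left(\left(\frac{4}{\sqrt{2e}}+O\left(\frac{(\log\log\log y)^2}{\log\log y}\right)\right)\frac{\sqrt{\log y}}{\log\log y}\right).$$ That is, there is an absolute constant $C>0$ such that for all real $x\ge 1$ and all real $y>e^{e^{e}}$, $$\frac{1}{y}\sum_{x\le n\le x+y} f(n)\ \ge\ \exp\left(\left(\frac{4}{\sqrt{2e}}-C\,\frac{(\log\log\log y)^2}{\log\log y}\right)\frac{\sqrt{\log y}}{\log\log y}\right).$$
   Context: For a positive integer $n$, $f(n)$ denotes the number of distinct unordered factorisations of $n$ into integer factors larger than $1$, i.e. the number of finite multisets of integers $>1$ whose product is $n$ (the one-factor factorisation $n$ itself is counted when $n>1$). For example $f(28)=4$, from $28,\ 2\cdot 14,\ 4\cdot 7,\ 2\cdot 2\cdot 7$. The sum runs over integers $n$ in $[x,x+y]$, and $\log$ is the natural logarithm. *)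

(* Defs.v *)
From HB Require Import structures.
From mathcomp Require Import all_boot all_order all_algebra.
From mathcomp Require Import finmap multiset.
From mathcomp Require Import all_classical all_reals all_analysis.

Set Implicit Arguments.
Unset Strict Implicit.
Unset Printing Implicit Defensive.

Import Order.TTheory GRing.Theory Num.Theory.

Local Open Scope classical_set_scope.
Local Open Scope mset_scope.
Local Open Scope nat_scope.

(* The empty multiset is the (only) factorisation of 1. *)
Definition factorisations (n : nat) : set {mset nat} :=
  [set m : {mset nat} | (forall d : nat, d \in m -> 1 < d) /\ \prod_(d <- m) d = n].

Lemma factorisation_bounds (n : nat) (m : {mset nat}) :
  0 < n -> factorisations n m ->
  size m <= n /\ (forall d, d \in m -> d <= n).
Proof.
move=> n0 [m1 mn].
have m1' d : d \in (m : seq nat) -> 1 < d by exact: m1.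
suff [sz le_prod] : size m < \prod_(d <- m) d /\
    forall d, d \in (m : seq nat) -> d <= \prod_(e <- m) e.
  by rewrite mn in sz le_prod; split => [|d dm]; [exact: ltnW|exact: le_prod].
elim: (m : seq nat) m1' => [|a s IHs] s1; first by rewrite big_nil.
rewrite big_cons /=.
have a1 : 1 < a by apply: s1; rewrite mem_head.
have [|sz le_prod] := IHs; first by move=> d ds; apply: s1; rewrite inE ds orbT.
have p0 : 0 < \prod_(e <- s) e by exact: leq_ltn_trans sz.
split; first by apply: leq_ltn_trans sz _; rewrite ltn_Pmull.
move=> d; rewrite inE => /orP[/eqP ->|/le_prod dp]; first exact: leq_pmulr.
by apply: leq_trans dp _; rewrite leq_pmull // ltnW.
Qed.

Lemma finite_factorisations (n : nat) :
  0 < n -> finite_set (factorisations n).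
Proof.
move=> n0.
pose h (s : n.-bseq 'I_n.+1) : {mset nat} := seq_mset (map val s).
apply: (@sub_finite_set _ _ (h @` setT)).
  move=> m /(factorisation_bounds n0) [sz le_n].
  have szb : size (map (@inord n) m) <= n by rewrite size_map.
  exists (Bseq szb) => //; rewrite /h /= -map_comp.
  have -> : map (val \o @inord n) m = m :> seq nat.
    rewrite -[RHS]map_id; apply/eq_in_map => d dm /=.
    by rewrite inordK // ltnS; apply: le_n.
  exact: seq_mset_id.
by apply: finite_image; exact: finite_finset.
Qed.

(* [fset_set A] is the finite set underlying A whenever A is finite (and is
   empty otherwise); factorisations n is finite for n > 0 by
   finite_factorisations. *)
Definition nb_factorisations (n : nat) : nat :=
  #|` fset_set (factorisations n) |.

(* Main.v *)
Require Import Defs.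
From mathcomp Require Import all_boot all_order all_algebra.
From mathcomp Require Import perm finmap multiset lra ring.
From mathcomp Require Import all_classical all_reals all_analysis.

Import Order.TTheory GRing.Theory Num.Theory.
Local Open Scope classical_set_scope.
Local Open Scope ring_scope.

(* Send a k-tuple (d_1, ..., d_k) of integers in [2, 2^r] and a cofactor q >= 2
   to the factorisation {d_1, ..., d_k, q} of n = q d_1 ... d_k; each
   factorisation has at most (k+1)! preimages. If y >= 4 * 2^(rk), at least
   y / (2 d_1 ... d_k) cofactors put n in [x, x+y], however large x is, so the
   mean of f over the interval is at least H^k / (2 (k+1)!), where
   H = \sum_(2 <= d <= 2^r) 1/d >= r/2. Taking r = 32(k+1) makes this at least
   16^k / 2 >= e^(k-1) as soon as log y >= 2 + 32k(k+1), so that k of order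
   sqrt(log y) / log log y is admissible once log log y is large; for bounded
   log log y a large C makes the right-hand side at most 1/e, which is the
   case k = 0. *)

Lemma card_sum_fibres (I : finType) (T : choiceType) (h : I -> T)
    (B : {fset T}) (P : pred I) :
  (forall i, P i -> h i \in B) ->
  #|P| = (\sum_(b <- B) #|[pred i | P i && (h i == b)]|)%N.
Proof.
move=> hB; rewrite -sum1_card.
under [RHS]eq_bigr do rewrite -sum1_card big_mkcondr /=.
rewrite exchange_big /=; apply: eq_bigr => i Pi.
rewrite -big_mkcond sum1_count /=.
have -> : count (fun b => h i == b) B = count_mem (h i) B.
  by apply: eq_count => b /=; rewrite eq_sym.
by rewrite count_uniq_mem ?fset_uniq// hB.
Qed.

(** Fix one index [i0] in [P]: every other tuple is [g i0] with its positions permuted, and choosing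
    one such permutation per index gives an injection into ['S_k]. *)
Lemma card_perm_eq_tuples (I : finType) (T : eqType) k (g : I -> k.-tuple T)
    (s : seq T) (P : pred I) :
  injective g -> (forall i, P i -> perm_eq (g i) s) -> (#|P| <= k`!)%N.
Proof.
move=> ginj gs; have [i0 Pi0|P0] := pickP P; last by rewrite eq_card0.
pose h i : 'S_k := odflt 1%g
  [pick p : 'S_k | tval (g i) == [tuple tnth (g i0) (p j) | j < k]].
have hP i : P i -> g i = [tuple tnth (g i0) (h i j) | j < k].
  move=> Pi; have : perm_eq (g i) (g i0).
    by rewrite (perm_trans (gs _ Pi))// perm_sym gs.
  rewrite /h => /tuple_permP[p pE]; case: pickP => [q /eqP qE|/(_ p)].
    exact/val_inj.
  by rewrite pE eqxx.
rewrite -card_Sn -(@card_in_imset _ _ h P) ?max_card//.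
by move=> i j Pi Pj hij; apply: ginj; rewrite (hP i Pi) (hP j Pj) hij.
Qed.

Lemma card_tuples_le_factorisations (I : finType) k (g : I -> k.-tuple nat)
    (A : {fset nat}) :
  injective g -> (forall i d, d \in g i -> (1 < d)%N) ->
  (forall i, (\prod_(d <- g i) d)%N \in A) ->
  (#|I| <= k`! * \sum_(n <- A) nb_factorisations n)%N.
Proof.
move=> ginj g1 gA.
rewrite (@card_sum_fibres _ _ (fun i => (\prod_(d <- g i) d)%N) A predT)//.
rewrite big_distrr /=; apply: leq_sum => n _.
set P := [pred i | _].
have [i Pi|P0] := pickP P; last by rewrite eq_card0.
have n0 : (0 < n)%N.
  by move: Pi => /= /eqP <-; rewrite big_seq prodn_cond_gt0// => d /g1 /ltnW.
have fin := finite_factorisations n0.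
rewrite (@card_sum_fibres _ _ (fun i => seq_mset (g i))
  (fset_set (factorisations n)) P).
  rewrite /nb_factorisations mulnC -sum1_size big_distrl /=.
  apply: leq_sum => b _; rewrite mul1n.
  pose Q i := P i && (seq_mset (g i) == b).
  apply: (@card_perm_eq_tuples _ _ _ g (b : {mset nat}%mset) Q) => //.
  by move=> j /andP[_ /eqP <-]; rewrite perm_sym perm_eq_seq_mset.
move=> j /= /eqP jn; rewrite in_fset_set// inE; split.
  by move=> d; rewrite (perm_mem (perm_eq_seq_mset _)); exact: g1.
by rewrite (perm_big _ (perm_eq_seq_mset _)).
Qed.

Section short_interval.
Variable R : realType.

Lemma finite_interval_nat (x y : R) :
  finite_set [set n : nat | x <= n%:R <= x + y].
Proof.
apply: (@sub_finite_set _ _ `I_((Num.trunc (x + y)).+1)); last exact: finite_II.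
move=> n /= /andP[_ ny]; rewrite -(ltr_nat R).
by rewrite (le_lt_trans ny)// truncnS_gt.
Qed.

Lemma sum_factorisations_ge (k m : nat) (x y : R) :
  1 <= x -> 4 * m.+1%:R ^+ k <= y ->
  y / 2 * (\sum_(j < m) (j.+2%:R : R)^-1) ^+ k <=
  (k.+1)`!%:R * \sum_(n \in [set n : nat | x <= n%:R <= x + y])
                   ((nb_factorisations n)%:R : R).
Proof.
move=> x1 my.
pose D (f : {ffun 'I_k -> 'I_m}) : nat := (\prod_i (f i).+2)%N.
have D0 f : (0 < D f)%N by rewrite prodn_gt0.
have D0R f : 0 < (D f)%:R :> R by rewrite ltr0n.
have Dle f : 4 * (D f)%:R <= y.
  apply: le_trans my; rewrite ler_pM2l// -natrX ler_nat.
  rewrite -[X in (_ <= _ ^ X)%N]card_ord -prod_nat_const.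
  by apply: leq_prod => i _; rewrite ltnS.
(* The cofactors start at [trunc (x / D f) + 2], hence exceed both 1 and [x / D f]; the off-by-one
   leaves [trunc (y / D f) - 1] of them up to [(x + y) / D f]. *)
pose J f := (Num.trunc (y / (D f)%:R)).-1.
pose q f (j : 'I_(J f)) := (Num.trunc (x / (D f)%:R) + j).+2.
pose I : finType := {f : {ffun 'I_k -> 'I_m} & 'I_(J f)}.
pose g (i : I) : k.+1.-tuple nat :=
  [tuple of q _ (tagged i) :: [tuple (tag i l).+2 | l < k]].
have ginj : injective g.
  move=> [f j] [f' j'] /(congr1 val)[/= qq ff].
  have ff' : f = f'.
    apply/ffunP => l; apply/val_inj.
    have /(congr1 (fun t => tnth t l)) :
        [tuple (f l).+2 | l < k] = [tuple (f' l).+2 | l < k] by exact/val_inj.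
    by rewrite !tnth_mktuple => -[].
  subst f'; congr (existT _ _ _); apply/val_inj.
  by move: qq => /addnI.
have gprod i : (\prod_(d <- g i) d = q _ (tagged i) * D (tag i))%N.
  by rewrite big_cons/= big_map big_enum.
set A := [set n : nat | _]; have finA : finite_set A := finite_interval_nat x y.
have le_card : (#|I| <= (k.+1)`! * \sum_(n <- fset_set A) nb_factorisations n)%N.
  apply: card_tuples_le_factorisations ginj _ _ => [i d|i].
    by rewrite inE => /orP[/eqP ->//|/mapP[l _ ->]].
  rewrite gprod in_fset_set// inE /A /=; case: i => f j /=.
  rewrite natrM -(ler_pdivrMr _ _ (D0R f)) -(ler_pdivlMr _ _ (D0R f)) mulrDl /q.
  have x0 : 0 <= x / (D f)%:R by rewrite divr_ge0// (le_trans _ x1).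
  have y0 : 0 <= y / (D f)%:R.
    by rewrite divr_ge0// (le_trans _ (Dle f))// mulr_ge0.
  have /andP[t1 t2] := truncn_itv x0.
  have /andP[t3 t4] := truncn_itv y0.
  apply/andP; split.
    by rewrite (le_trans (ltW t2))// ler_nat ltnS leqW// leq_addr.
  rewrite -addnS -addnS natrD lerD// (le_trans _ t3)// ler_nat.
  move: (nat_of_ord j) (ltn_ord j) => {}j; rewrite /J.
  by case: (Num.trunc (y / _)).
rewrite fsbig_finite//= -natr_sum -natrM.
apply: le_trans (_ : #|I|%:R <= _); last by rewrite ler_nat.
rewrite card_tagged sumnE big_map big_enum /= natr_sum.
(* Expanding the [k]-th power over all functions [f] yields the sum of the [1 / D f], to be compared
   with the [J f] term by term. *)
rewrite -[k in X in X <= _]card_ord -prodr_const bigA_distr_bigA /= mulr_sumr.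
apply: ler_sum => f _; rewrite card_ord prodfV -natr_prod -/(D f).
(* For [z >= 4], [trunc z - 1 > z - 2 >= z / 2]; this is the source of the factor 4 in the
   hypothesis. *)
have D4 : 4 <= y / (D f)%:R by rewrite ler_pdivlMr.
have := truncnS_gt (y / (D f)%:R); rewrite /J -mulrAC.
have : (2 <= Num.trunc (y / (D f)%:R))%N.
  by rewrite truncn_ge_nat; lra.
case: (Num.trunc _) => // -[//|u] _ /=; rewrite -[u.+3]addn2 natrD; lra.
Qed.

(** The block of denominators from [2^r + 1] to [2^(r+1)] has [2^r] terms, each at least
    [1 / 2^(r+1)], so it adds at least 1/2. *)
Lemma harmonic_dyadic_ge (r : nat) :
  r%:R / 2 <= \sum_(j < (2 ^ r).-1) (j.+2%:R : R)^-1.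
Proof.
rewrite -(big_mkord xpredT (fun j => (j.+2%:R : R)^-1)).
elim: r => [|r IHr]; first by rewrite big_geq// mul0r.
have r0 : (0 < 2 ^ r)%N by rewrite expn_gt0.
rewrite (@big_cat_nat _ _ _ (2 ^ r).-1)//=; last first.
  by rewrite -!subn1 leq_sub2r// leq_exp2l.
rewrite -addn1 natrD mulrDl lerD//.
have -> : 1 / 2 = \sum_((2 ^ r).-1 <= j < (2 ^ (r + 1)).-1) ((2 ^ r.+1)%:R : R)^-1.
  rewrite sumr_const_nat.
  have -> : ((2 ^ (r + 1)).-1 - (2 ^ r).-1 = 2 ^ r)%N.
    by rewrite addn1 expnS mul2n -addnn -!subn1 -subnDA subnKC// addnK.
  rewrite -[RHS]mulr_natr expnS natrM invfM -mulrA mulVf ?mulr1 ?div1r//.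
apply: ler_sum_nat => j /andP[_ jr]; rewrite lef_pV2 ?posrE ?ltr0n ?expn_gt0//.
by rewrite ler_nat; move: jr; rewrite -ltnS prednK ?expn_gt0// addn1.
Qed.

(** The exponent is [k] so that the factorial cancels against [(16 * k.+1) ^ k], leaving exactly
    [16 ^ k]. *)
Lemma fact_succ_le (k : nat) : ((k.+1)`! <= k.+1 ^ k)%N.
Proof.
elim: k => // k IHk; rewrite factS expnS leq_mul2l/=.
by rewrite (leq_trans IHk)//; case: k {IHk} => // k; rewrite leq_exp2r.
Qed.

Lemma mean_factorisations_ge (k : nat) (x y : R) :
  1 <= x -> 2 + 32 * (k * k.+1)%:R <= ln y ->
  expR (k%:R - 1) <=
  y^-1 * \sum_(n \in [set n : nat | x <= n%:R <= x + y])
            ((nb_factorisations n)%:R : R).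
Proof.
move=> x1 ly; set S := \sum_(n \in _) _.
have e2 : 2 <= expR 1 :> R by have := expR_ge1Dx (1 : R); lra.
have e4 : expR 1 <= 4 :> R.
  have h : expR 2^-1 * expR (- 2^-1) = 1 :> R by rewrite -expRD subrr expR0.
  have := expR_ge1Dx (- 2^-1 : R) => h1.
  have h2 : expR 2^-1 <= 2 :> R.
    by have := expR_gt0 (2^-1 : R); nra.
  have -> : 1 = 2^-1 + 2^-1 :> R by field.
  by rewrite expRD; have := expR_gt0 (2^-1 : R); nra.
(* [ln] takes the default value 0 at nonpositive reals, which the lower bound on [ln y] excludes. *)
have y0 : 0 < y.
  rewrite ltNge; apply/negP => /ln0 yN; move: ly; rewrite yN.
  by have := ler0n R (k * k.+1); lra.
pose r := (32 * k.+1)%N.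
have yr : 4 * ((2 ^ r).-1).+1%:R ^+ k <= y.
  rewrite -[y]lnK ?posrE//; apply: le_trans (_ : expR (2 + (r * k)%:R) <= _).
    rewrite prednK ?expn_gt0// natrX -exprM expRD; apply: ler_pM => //.
    - by rewrite -[X in expR X]mulr1 expRM_natl; nra.
    - by rewrite -[X in expR X]mulr1 expRM_natl lerXn2r ?nnegrE ?(le_trans _ e2).
  rewrite ler_expR; apply: le_trans ly; rewrite /r mulnAC -mulnA natrM.
  by rewrite mulnC.
have := @sum_factorisations_ge k _ x y x1 yr; rewrite -/S => main.
have Hk : (16 * k.+1%:R) ^+ k <= (\sum_(j < (2 ^ r).-1) (j.+2%:R : R)^-1) ^+ k.
  rewrite lerXn2r ?nnegrE ?mulr_ge0 ?sumr_ge0//.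
  by apply: le_trans (harmonic_dyadic_ge r); rewrite /r natrM; lra.
have S0 : 0 <= S.
  by rewrite /S fsbig_finite ?sumr_ge0//; exact: finite_interval_nat.
have kk : (k.+1)`!%:R <= k.+1%:R ^+ k :> R by rewrite -natrX ler_nat fact_succ_le.
have k0 : 0 < k.+1%:R ^+ k :> R by rewrite exprn_gt0.
have : y / 2 * 16 ^+ k <= S.
  rewrite -(ler_pM2r k0) -(mulrA (y / 2)) -exprMn [leRHS]mulrC.
  apply: le_trans (_ : _ <= (k.+1)`!%:R * S) _; last by rewrite ler_wpM2r.
  by apply: le_trans main; rewrite ler_wpM2l// divr_ge0// ltW.
move=> yS; rewrite ler_pdivlMl//; apply: le_trans yS.
rewrite -mulrA ler_pM2l// [leRHS]mulrC expRD ler_pM ?expR_ge0//.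
  rewrite -[X in expR X]mulr1 expRM_natl lerXn2r ?nnegrE ?expR_ge0//.
  by apply: le_trans e4 _; rewrite ler_nat.
by rewrite expRN lef_pV2 ?posrE ?expR_gt0.
Qed.

End short_interval.

Theorem theorem2 (R : realType) :
  exists C : R, 0 < C /\
    forall x y : R, 1 <= x -> expR (expR (expR 1)) < y ->
      expR ((4 / Num.sqrt (2 * expR 1)
             - C * ((ln (ln (ln y))) ^+ 2 / ln (ln y)))
            * (Num.sqrt (ln y) / ln (ln y)))
      <= y^-1 * \sum_(n \in [set n : nat | x <= n%:R <= x + y])
                   ((nb_factorisations n)%:R : R).
Proof.
(* 144 is 3 * 48: if [l < 48], then [ln l > 1] makes the error term at least 3, and the coefficient
   at most 2 - 3 = -1. *)
exists 144; split=> // x y x1 ey.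
have ltln (a b : R) : expR a < b -> a < ln b.
  by move=> ab; rewrite -ltr_expR lnK// posrE (lt_trans _ ab)// expR_gt0.
set L := ln y; set l := ln L; set t := Num.sqrt L / l.
have eL : expR (expR 1) < L by exact: ltln.
have el : expR 1 < l by exact: ltln.
have ll1 : 1 < ln l by exact: ltln.
have e2 : 2 <= expR 1 :> R by have := expR_ge1Dx (1 : R); lra.
have l0 : 0 < l by lra.
have L0 : 0 < L by rewrite (lt_trans _ eL)// expR_gt0.
have c2 : 4 / Num.sqrt (2 * expR 1) <= 2 :> R.
  have s2 : 2 <= Num.sqrt (2 * expR 1) :> R.
    rewrite -[leLHS](ger0_norm (ler0n R 2)) -sqrtr_sqr.
    by rewrite ler_sqrt; nra.
  by rewrite ler_pdivrMr; lra.
(* This is [l ^ 2 <= expR l], from [expR (l / 4) >= 1 + l / 4] and [(1 + l / 4) ^ 2 >= l]. *)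
have t1 : 1 <= t.
  rewrite ler_pdivlMr// mul1r -[l]ger0_norm ?(ltW l0)// -sqrtr_sqr.
  rewrite ler_sqrt ?(ltW L0)// -[L]lnK ?posrE// -/l.
  have -> : expR l = (expR (l / 4) ^+ 2) ^+ 2.
    by rewrite -exprM -expRM_natl; congr expR; field.
  rewrite lerXn2r ?nnegrE ?exprn_ge0 ?expR_ge0 ?(ltW l0)//.
  apply: le_trans (_ : (1 + l / 4) ^+ 2 <= _).
    by have := sqr_ge0 (1 - l / 4); lra.
  by rewrite lerXn2r ?nnegrE ?expR_ge0 ?expR_ge1Dx//; lra.
have tL : t ^+ 2 * l ^+ 2 = L.
  by rewrite -exprMn divfK ?gt_eqF// sqr_sqrtr// ltW.
have ratio0 : 0 <= (ln l) ^+ 2 / l by rewrite divr_ge0 ?sqr_ge0// ltW.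
have [l48|l48] := leP 48 l.
  (* Now [k - 1 > 2 * t] dominates the exponent, while [k <= 2 * t + 2 <= 4 * t] because
     [t >= 1]. *)
  pose k := (Num.trunc (2 * t)).+2.
  have k0 : 0 <= 2 * t by lra.
  have /andP[k1 k2] := truncn_itv k0.
  have kE : k%:R = (Num.trunc (2 * t))%:R + 2 :> R by rewrite /k -addn2 natrD.
  have kSE : (Num.trunc (2 * t)).+1%:R = (Num.trunc (2 * t))%:R + 1 :> R.
    by rewrite -addn1 natrD.
  apply: (le_trans _ (@mean_factorisations_ge _ k x y x1 _)).
    by rewrite ler_expR; nra.
  (* As [k * (k + 1) <= 20 * t ^ 2], the left side is at most [642 * t ^ 2], below
     [48 ^ 2 * t ^ 2 <= L]. *)
  rewrite natrM -[k.+1%:R]natr1 -/L -tL.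
  have : k%:R <= 4 * t by lra.
  have : 0 <= k%:R :> R by [].
  have : 48 * 48 <= l ^+ 2 by nra.
  nra.
apply: (le_trans _ (@mean_factorisations_ge _ 0 x y x1 _)).
  rewrite ler_expR.
  have : 48^-1 <= ln l ^+ 2 / l by rewrite ler_pdivlMr//; nra.
  nra.
rewrite -/L; have := expR_ge1Dx (expR 1 : R); lra.
Qed.
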